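(* Work in the type theory ILDTT (described in the context). Let $\Delta;\cdot\vdash A\;\mathrm{type}$. If ILDTT has $\Sigma$-types and $I$-types, then the type $\Sigma_{!x:!A}I$ (with suitably defined term formers) satisfies all the rules for $!A$. Conversely, if ILDTT has $!$-types and $I$-types, then $!A$ satisfies all the rules for $\Sigma_{!x:!A}I$ (where $x$ does not occur in $I$).
   Context: ILDTT (intuitionistic linear dependent type theory) has judgements $\vdash\Delta;\Xi\;\mathrm{ctxt}$, $\Delta;\cdot\vdash A\;\mathrm{type}$, $\Delta;\Xi\vdash a:A$ and the corresponding judgemental equalities ($\equiv$). A context $\Delta;\Xi$ has an intuitionistic region $\Delta$ and a linear region $\Xi$; both may be extended by types $A$ with $\Delta;\cdot\vdash A\;\mathrm{type}$, so types depend only on intuitionistic variables. Structural rules: $\Delta,x:A,\Delta';\cdot\vdash x:A$ and $\Delta;x:A\vdash x:A$; judgemental equality is an equivalence relation compatible with typing and all formers; weakening and exchange for intuitionistic variables, exchange only for linear variables; substitution of $\Delta;\cdot\vdash a:A$ for intuitionistic variables in types and terms; linear substitution: from $\Delta;\Xi,x:A\vdash b:B$ and $\Delta;\Xi'\vdash a:A$ infer $\Delta;\Xi,\Xi'\vdash b[a/x]:B$. All commuting conversions of let-constructs with linear program contexts hold. $I$-types: $\Delta;\cdot\vdash I\;\mathrm{type}$; $\Delta;\cdot\vdash *:I$; from $\Delta;\Xi'\vdash t:I$ and $\Delta;\Xi\vdash a:A$ get $\Delta;\Xi,\Xi'\vdash\mathrm{let}\,t\,\mathrm{be}\,*\,\mathrm{in}\,a:A$;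 $\mathrm{let}\,*\,\mathrm{be}\,*\,\mathrm{in}\,a\equiv a$; $\mathrm{let}\,t\,\mathrm{be}\,*\,\mathrm{in}\,*\equiv t$. $!$-types: from $\Delta;\cdot\vdash A\;\mathrm{type}$ form $!A$; $\Delta;\cdot\vdash a:A$ gives $\Delta;\cdot\vdash !a:!A$; from $\Delta;\Xi\vdash t:!A$ and $\Delta,x:A;\Xi'\vdash b:B$ get $\Delta;\Xi,\Xi'\vdash\mathrm{let}\,t\,\mathrm{be}\,!x\,\mathrm{in}\,b:B$; $\mathrm{let}\,!a\,\mathrm{be}\,!x\,\mathrm{in}\,b\equiv b[a/x]$; $\mathrm{let}\,t\,\mathrm{be}\,!x\,\mathrm{in}\,!x\equiv t$. $\Sigma$-types: from $\Delta,x:A;\cdot\vdash B\;\mathrm{type}$ form $\Sigma_{!x:!A}B$; from $\Delta;\cdot\vdash a:A$ and $\Delta;\Xi\vdash b:B[a/x]$ get $\Delta;\Xi\vdash !a\otimes b:\Sigma_{!x:!A}B$; from $\Delta;\cdot\vdash C\;\mathrm{type}$, $\Delta;\Xi\vdash t:\Sigma_{!x:!A}B$, $\Delta,x:A;\Xi',y:B\vdash c:C$ get $\Delta;\Xi,\Xi'\vdash\mathrm{let}\,t\,\mathrm{be}\,!x\otimes y\,\mathrm{in}\,c:C$; $\mathrm{let}\,!a\otimes b\,\mathrm{be}\,!x\otimes y\,\mathrm{in}\,c\equiv c[a/x,b/y]$; $\mathrm{let}\,t\,\mathrm{be}\,!x\otimes y\,\mathrm{in}\,!x\otimes y\equiv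 t$. *)

(* Defs.v *)
(* MathComp *)
From Stdlib Require List.
From mathcomp Require Import all_boot.

Set Implicit Arguments.
Unset Strict Implicit.
Unset Printing Implicit Defensive.

(* Raw types and terms share one syntactic sort; the judgements separate them.
   [IVar] and [LVar] are de Bruijn indices in two independent index spaces.
   [Op o args] is an operator of an arbitrary signature [O] (base types,
   constants, further type and term formers, whose rules, including
   congruences, are supplied as additional rules); an argument
   [(i, l, e)] binds [i] intuitionistic and [l] linear variables in [e].
   Binders: [Sigma A B] and [LetBang t b] bind one intuitionistic variable in
   [B], resp. [b]; [LetPair t c] binds one intuitionistic and one linear
   variable in [c]. *)
Inductive exp (O : Type) : Type :=
| IVar of nat
| LVar of nat
| Op of O & seq (nat * nat * exp O)
| Unit
| Star
| LetStar of exp O & exp O  (* let t be * in a *)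
| Bang of exp O             (* the type !A *)
| BangI of exp O            (* the term !a *)
| LetBang of exp O & exp O  (* let t be !x in b *)
| Sigma of exp O & exp O    (* Sigma_{!x:!A} B *)
| Pair of exp O & exp O     (* !a (x) b *)
| LetPair of exp O & exp O. (* let t be !x (x) y in c *)

Arguments IVar {O} _.
Arguments LVar {O} _.
Arguments Unit {O}.
Arguments Star {O}.

Section Syntax.
Variable O : Type.
Local Notation exp := (exp O).

Definition upren (k : nat) (r : nat -> nat) (n : nat) : nat :=
  if n < k then n else k + r (n - k).

Fixpoint ren (ri rl : nat -> nat) (e : exp) : exp :=
  match e with
  | IVar n => IVar (ri n)
  | LVar n => LVar (rl n)
  | Op o args =>
      Op o [seq (a.1, ren (upren a.1.1 ri) (upren a.1.2 rl) a.2) | a <- args]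
  | Unit => Unit
  | Star => Star
  | LetStar t a => LetStar (ren ri rl t) (ren ri rl a)
  | Bang A => Bang (ren ri rl A)
  | BangI a => BangI (ren ri rl a)
  | LetBang t b => LetBang (ren ri rl t) (ren (upren 1 ri) rl b)
  | Sigma A B => Sigma (ren ri rl A) (ren (upren 1 ri) rl B)
  | Pair a b => Pair (ren ri rl a) (ren ri rl b)
  | LetPair t c => LetPair (ren ri rl t) (ren (upren 1 ri) (upren 1 rl) c)
  end.

(* Lifting of a substitution under [i] intuitionistic and [l] linear binders. *)
Definition upI (i l : nat) (s : nat -> exp) (n : nat) : exp :=
  if n < i then IVar n else ren (addn i) (addn l) (s (n - i)).
Definition upL (i l : nat) (s : nat -> exp) (n : nat) : exp :=
  if n < l then LVar n else ren (addn i) (addn l) (s (n - l)).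

Fixpoint subst (si sl : nat -> exp) (e : exp) : exp :=
  match e with
  | IVar n => si n
  | LVar n => sl n
  | Op o args =>
      Op o [seq (a.1, subst (upI a.1.1 a.1.2 si) (upL a.1.1 a.1.2 sl) a.2)
           | a <- args]
  | Unit => Unit
  | Star => Star
  | LetStar t a => LetStar (subst si sl t) (subst si sl a)
  | Bang A => Bang (subst si sl A)
  | BangI a => BangI (subst si sl a)
  | LetBang t b => LetBang (subst si sl t) (subst (upI 1 0 si) (upL 1 0 sl) b)
  | Sigma A B => Sigma (subst si sl A) (subst (upI 1 0 si) (upL 1 0 sl) B)
  | Pair a b => Pair (subst si sl a) (subst si sl b)
  | LetPair t c => LetPair (subst si sl t) (subst (upI 1 1 si) (upL 1 1 sl) c)
  end.

Definition scons (a : exp) (s : nat -> exp) (n : nat) : exp :=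
  if n is m.+1 then s m else a.

Definition ish (e : exp) : exp := ren S id e.

(* [isub a b] is b[a/x] for the last intuitionistic variable x, [lsub a b] is
   b[a/y] for the linear variable y of index 0, and [ilsub a b c] is
   c[a/x, b/y].  [isub_at d a] is the first one with the substituted variable
   below [d] further intuitionistic variables. *)
Definition isub (a : exp) : exp -> exp := subst (scons a IVar) LVar.
Definition lsub (a : exp) : exp -> exp := subst IVar (scons a LVar).
Definition ilsub (a b : exp) : exp -> exp :=
  subst (scons a IVar) (scons b LVar).
Definition isub_at (d : nat) (a : exp) : exp -> exp :=
  subst (upI d 0 (scons a IVar)) LVar.

Definition iweak_at (d : nat) : exp -> exp := ren (upren d S) id.
Definition swap01 (n : nat) : nat :=
  match n with 0 => 1 | 1 => 0 | _ => n end.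
Definition iswap_at (d : nat) : exp -> exp := ren (upren d swap01) id.

(* The intuitionistic region is a telescope with its last declaration at the
   head of the list, so [D' ++ A :: D] stands for "D, x:A, D'".
   The linear region lists, from left to right, the names of the free linear
   variables with their types; the name of a free linear variable is its index.
   Types never depend on linear variables. *)
Definition ictx := seq exp.
Definition lctx := seq (nat * exp).

(* Acts on D' in "D, D'": an entry with [d] entries of D' to its left is sent
   through [f d]. *)
Fixpoint tele (f : nat -> exp -> exp) (D' : ictx) : ictx :=
  if D' is A :: D'' then f (size D'') A :: tele f D'' else [::].

Definition ltypes (f : exp -> exp) (X : lctx) : lctx :=
  [seq (p.1, f p.2) | p <- X].
Definition lnames (r : nat -> nat) (X : lctx) : lctx :=
  [seq (r p.1, p.2) | p <- X].

(* "X, y:B" seen from under the binder of y, which takes the index 0. *)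
Definition lext (X : lctx) (B : exp) : lctx := lnames S X ++ [:: (0, B)].

(* The convention that the variables of a linear region have distinct names is
   a side condition of the rules that concatenate regions. *)
Definition distinct (X : lctx) : bool := uniq (unzip1 X).

Inductive statement : Type :=
| IsTy of exp
| EqTy of exp & exp
| IsTm of exp & exp         (* a : A *)
| EqTm of exp & exp & exp.  (* a = a' : A *)

Definition smap (f g : exp -> exp) (s : statement) : statement :=
  match s with
  | IsTy A => IsTy (f A)
  | EqTy A A' => EqTy (f A) (f A')
  | IsTm a A => IsTm (g a) (f A)
  | EqTm a a' A => EqTm (g a) (g a') (f A)
  end.

Inductive judgement : Type :=
| Ctx of ictx & lctx
| CtxEq of ictx & lctx & ictx & lctx
| Jdg of ictx & lctx & statement.

Definition Ty D A := Jdg D [::] (IsTy A).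
Definition TyEq D A A' := Jdg D [::] (EqTy A A').
Definition Tm D X a A := Jdg D X (IsTm a A).
Definition TmEq D X a a' A := Jdg D X (EqTm a a' A).

(* A set of rules: [R ps c] says that "from ps infer c" is an instance. *)
Definition rules := seq judgement -> judgement -> Prop.

Definition closed_under (R : rules) (T : judgement -> Prop) : Prop :=
  forall ps c, R ps c -> (forall p, List.In p ps -> T p) -> T c.

Inductive derivable (R : rules) : judgement -> Prop :=
| by_rule ps c :
    R ps c -> (forall p, List.In p ps -> derivable R p) -> derivable R c.

Definition rules_union (R R' : rules) : rules :=
  fun ps c => R ps c \/ R' ps c.

(* [s_lname] makes the names of linear variables immaterial. *)
Inductive structural_rules : rules :=
| s_ctx_nil : structural_rules [::] (Ctx [::] [::])
| s_ctx_int D X A :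
    structural_rules [:: Ctx D X; Ty D A] (Ctx (A :: D) (ltypes ish X))
| s_ctx_lin D X x A : distinct (X ++ [:: (x, A)]) ->
    structural_rules [:: Ctx D X; Ty D A] (Ctx D (X ++ [:: (x, A)]))
| s_ctxeq_int D X D' X' A A' :
    structural_rules [:: CtxEq D X D' X'; TyEq D A A']
      (CtxEq (A :: D) (ltypes ish X) (A' :: D') (ltypes ish X'))
| s_ctxeq_lin D X D' X' x A A' :
    distinct (X ++ [:: (x, A)]) -> distinct (X' ++ [:: (x, A')]) ->
    structural_rules [:: CtxEq D X D' X'; TyEq D A A']
      (CtxEq D (X ++ [:: (x, A)]) D' (X' ++ [:: (x, A')]))
| s_ivar D A D' :
    structural_rules [:: Ctx (D' ++ A :: D) [::]]
      (Tm (D' ++ A :: D) [::] (IVar (size D')) (iter (size D').+1 ish A))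
| s_lvar D x A :
    structural_rules [:: Ctx D [:: (x, A)]] (Tm D [:: (x, A)] (LVar x) A)
| s_ctx_refl D X : structural_rules [:: Ctx D X] (CtxEq D X D X)
| s_ctx_sym D X D' X' :
    structural_rules [:: CtxEq D X D' X'] (CtxEq D' X' D X)
| s_ctx_trans D X D' X' D'' X'' :
    structural_rules [:: CtxEq D X D' X'; CtxEq D' X' D'' X'']
      (CtxEq D X D'' X'')
| s_ty_refl D A : structural_rules [:: Ty D A] (TyEq D A A)
| s_ty_sym D A A' : structural_rules [:: TyEq D A A'] (TyEq D A' A)
| s_ty_trans D A A' A'' :
    structural_rules [:: TyEq D A A'; TyEq D A' A''] (TyEq D A A'')
| s_tm_refl D X a A : structural_rules [:: Tm D X a A] (TmEq D X a a A)
| s_tm_sym D X a a' A :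
    structural_rules [:: TmEq D X a a' A] (TmEq D X a' a A)
| s_tm_trans D X a a' a'' A :
    structural_rules [:: TmEq D X a a' A; TmEq D X a' a'' A]
      (TmEq D X a a'' A)
| s_conv_ctx D X D' X' s :
    structural_rules [:: Jdg D X s; CtxEq D X D' X'] (Jdg D' X' s)
| s_conv_tm D X a A A' :
    structural_rules [:: Tm D X a A; TyEq D A A'] (Tm D X a A')
| s_conv_tmeq D X a a' A A' :
    structural_rules [:: TmEq D X a a' A; TyEq D A A'] (TmEq D X a a' A')
| s_weak D A D' X s :
    let f := iweak_at in let n := size D' in
    structural_rules [:: Ty D A; Jdg (D' ++ D) X s]
      (Jdg (tele f D' ++ A :: D) (ltypes (f n) X) (smap (f n) (f n) s))
| s_exch D A B D' X s :
    let f := iswap_at in let n := size D' in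
    structural_rules [:: Ty D A; Ty D B; Jdg (D' ++ ish B :: A :: D) X s]
      (Jdg (tele f D' ++ ish A :: B :: D) (ltypes (f n) X)
           (smap (f n) (f n) s))
| s_subst D A D' X a s :
    let f d := isub_at d a in let n := size D' in
    structural_rules [:: Tm D [::] a A; Jdg (D' ++ A :: D) X s]
      (Jdg (tele f D' ++ D) (ltypes (f n) X) (smap (f n) (f n) s))
| s_subst_ty_eq D A D' a a' B :
    let f d := isub_at d a in let f' d := isub_at d a' in let n := size D' in
    structural_rules [:: TmEq D [::] a a' A; Ty (D' ++ A :: D) B]
      (TyEq (tele f D' ++ D) (f n B) (f' n B))
| s_subst_tm_eq D A D' X a a' b B :
    let f d := isub_at d a in let f' d := isub_at d a' in let n := size D' in
    structural_rules [:: TmEq D [::] a a' A; Tm (D' ++ A :: D) X b B]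
      (TmEq (tele f D' ++ D) (ltypes (f n) X) (f n b) (f' n b) (f n B))
| s_lexch D X X' p q s :
    structural_rules [:: Jdg D (X ++ p :: q :: X') s]
      (Jdg D (X ++ q :: p :: X') s)
| s_lname D X r s : injective r ->
    structural_rules [:: Jdg D X s] (Jdg D (lnames r X) (smap id (ren id r) s))
| s_lsubst D X X' A a s : distinct (X ++ X') ->
    structural_rules [:: Jdg D (lext X A) s; Tm D X' a A]
      (Jdg D (X ++ X') (smap id (lsub a) s))
| s_lsubst_eq D X X' A a a' b B : distinct (X ++ X') ->
    structural_rules [:: Tm D (lext X A) b B; TmEq D X' a a' A]
      (TmEq D (X ++ X') (lsub a b) (lsub a' b) B).

(* In the commuting conversions below, a linear program context is a term with
   a linear variable of index 0 marking its hole, so that the hole is not under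
   a "!", and [lsub] fills the hole.  Contexts binding variables of the filling
   need no separate rule: a filling [LetBang t b] where b, but not t, uses
   variables bound by the context, is obtained by substituting
   t = [LetBang t (BangI (IVar 0))] for z in the context filled with
   "let z be !x in b"; likewise for the other eliminators. *)

Inductive unit_rules : rules :=
| unit_F D : unit_rules [:: Ctx D [::]] (Ty D Unit)
| unit_I D : unit_rules [:: Ctx D [::]] (Tm D [::] Star Unit)
| unit_E D X X' t a A : distinct (X ++ X') ->
    unit_rules [:: Tm D X' t Unit; Tm D X a A]
      (Tm D (X ++ X') (LetStar t a) A)
| unit_E_eq D X X' t t' a a' A : distinct (X ++ X') ->
    unit_rules [:: TmEq D X' t t' Unit; TmEq D X a a' A]
      (TmEq D (X ++ X') (LetStar t a) (LetStar t' a') A)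
| unit_beta D X a A : distinct X ->
    unit_rules [:: Tm D X a A] (TmEq D X (LetStar Star a) a A)
| unit_eta D X t : distinct X ->
    unit_rules [:: Tm D X t Unit] (TmEq D X (LetStar t Star) t Unit)
| unit_comm D X X' X'' t a A c C : distinct (X'' ++ X ++ X') ->
    unit_rules [:: Tm D X' t Unit; Tm D X a A; Tm D (lext X'' A) c C]
      (TmEq D (X'' ++ X ++ X')
         (lsub (LetStar t a) c) (LetStar t (lsub a c)) C).

(* The rules for !-types, for a type former [bng] with introduction [bi] and
   elimination [lb]. *)
Inductive bang_rules (bng : exp -> exp) (bi : exp -> exp)
    (lb : exp -> exp -> exp) : rules :=
| bang_F D A :
    bang_rules bng bi lb [:: Ctx D [::]; Ty D A] (Ty D (bng A))
| bang_F_eq D A A' :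
    bang_rules bng bi lb [:: Ctx D [::]; Ty D A; Ty D A'; TyEq D A A']
      (TyEq D (bng A) (bng A'))
| bang_I D A a :
    bang_rules bng bi lb [:: Ctx D [::]; Ty D A; Tm D [::] a A]
      (Tm D [::] (bi a) (bng A))
| bang_I_eq D A a a' :
    bang_rules bng bi lb [:: Ctx D [::]; Ty D A; TmEq D [::] a a' A]
      (TmEq D [::] (bi a) (bi a') (bng A))
| bang_E D A B X X' t b : distinct (X ++ X') ->
    bang_rules bng bi lb
      [:: Ctx D [::]; Ty D A; Ty D B;
          Tm D X t (bng A); Tm (A :: D) (ltypes ish X') b (ish B)]
      (Tm D (X ++ X') (lb t b) B)
| bang_E_eq D A B X X' t t' b b' : distinct (X ++ X') ->
    bang_rules bng bi lb
      [:: Ctx D [::]; Ty D A; Ty D B;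
          TmEq D X t t' (bng A); TmEq (A :: D) (ltypes ish X') b b' (ish B)]
      (TmEq D (X ++ X') (lb t b) (lb t' b') B)
| bang_beta D A B X a b : distinct X ->
    bang_rules bng bi lb
      [:: Ctx D [::]; Ty D A; Ty D B;
          Tm D [::] a A; Tm (A :: D) (ltypes ish X) b (ish B)]
      (TmEq D X (lb (bi a) b) (isub a b) B)
| bang_eta D A X t : distinct X ->
    bang_rules bng bi lb [:: Ctx D [::]; Ty D A; Tm D X t (bng A)]
      (TmEq D X (lb t (bi (IVar 0))) t (bng A))
| bang_comm D A B C X X' X'' t b c : distinct (X'' ++ X ++ X') ->
    bang_rules bng bi lb
      [:: Ctx D [::]; Ty D A; Ty D B; Ty D C;
          Tm D X t (bng A); Tm (A :: D) (ltypes ish X') b (ish B);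
          Tm D (lext X'' B) c C]
      (TmEq D (X'' ++ X ++ X') (lsub (lb t b) c) (lb t (lsub b (ish c))) C).

(* The rules for the types Sigma_{!x:!A} B with B in [fam], for a type former
   [sg] with introduction [pr] and elimination [lp].
   In [sigma_comm] the program context d is weakened by x and y; its hole keeps
   the index 0. *)
Inductive sigma_rules (fam : exp -> Prop) (sg : exp -> exp -> exp)
    (pr : exp -> exp -> exp) (lp : exp -> exp -> exp) : rules :=
| sigma_F D A B : fam B ->
    sigma_rules fam sg pr lp
      [:: Ctx D [::]; Ty D A; Ty (A :: D) B] (Ty D (sg A B))
| sigma_F_eq D A A' B B' : fam B -> fam B' ->
    sigma_rules fam sg pr lp
      [:: Ctx D [::]; Ty D A; Ty (A :: D) B; Ty D A'; Ty (A' :: D) B';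
          TyEq D A A'; TyEq (A :: D) B B']
      (TyEq D (sg A B) (sg A' B'))
| sigma_I D A B X a b : fam B -> distinct X ->
    sigma_rules fam sg pr lp
      [:: Ctx D [::]; Ty D A; Ty (A :: D) B;
          Tm D [::] a A; Tm D X b (isub a B)]
      (Tm D X (pr a b) (sg A B))
| sigma_I_eq D A B X a a' b b' : fam B -> distinct X ->
    sigma_rules fam sg pr lp
      [:: Ctx D [::]; Ty D A; Ty (A :: D) B;
          TmEq D [::] a a' A; TmEq D X b b' (isub a B)]
      (TmEq D X (pr a b) (pr a' b') (sg A B))
| sigma_E D A B C X X' t c : fam B -> distinct (X ++ X') ->
    sigma_rules fam sg pr lp
      [:: Ctx D [::]; Ty D A; Ty (A :: D) B; Ty D C;
          Tm D X t (sg A B);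
          Tm (A :: D) (lext (ltypes ish X') B) c (ish C)]
      (Tm D (X ++ X') (lp t c) C)
| sigma_E_eq D A B C X X' t t' c c' : fam B -> distinct (X ++ X') ->
    sigma_rules fam sg pr lp
      [:: Ctx D [::]; Ty D A; Ty (A :: D) B; Ty D C;
          TmEq D X t t' (sg A B);
          TmEq (A :: D) (lext (ltypes ish X') B) c c' (ish C)]
      (TmEq D (X ++ X') (lp t c) (lp t' c') C)
| sigma_beta D A B C X X' a b c : fam B -> distinct (X ++ X') ->
    sigma_rules fam sg pr lp
      [:: Ctx D [::]; Ty D A; Ty (A :: D) B; Ty D C;
          Tm D [::] a A; Tm D X b (isub a B);
          Tm (A :: D) (lext (ltypes ish X') B) c (ish C)]
      (TmEq D (X ++ X') (lp (pr a b) c) (ilsub a b c) C)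
| sigma_eta D A B X t : fam B -> distinct X ->
    sigma_rules fam sg pr lp
      [:: Ctx D [::]; Ty D A; Ty (A :: D) B; Tm D X t (sg A B)]
      (TmEq D X (lp t (pr (IVar 0) (LVar 0))) t (sg A B))
| sigma_comm D A B C C' X X' X'' t c d : fam B -> distinct (X'' ++ X ++ X') ->
    sigma_rules fam sg pr lp
      [:: Ctx D [::]; Ty D A; Ty (A :: D) B; Ty D C; Ty D C';
          Tm D X t (sg A B);
          Tm (A :: D) (lext (ltypes ish X') B) c (ish C);
          Tm D (lext X'' C) d C']
      (TmEq D (X'' ++ X ++ X')
         (lsub (lp t c) d) (lp t (lsub c (ren S (upren 1 S) d))) C').

(* ILDTT with the type formers whose rules are in [R]. *)
Definition ILDTT (R : rules) : judgement -> Prop :=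
  derivable (rules_union structural_rules R).

(* Defined term formers commute with substitution, like primitive ones. *)
Definition bang_formers (bi : exp -> exp) (lb : exp -> exp -> exp) : Prop :=
  (forall si sl a, subst si sl (bi a) = bi (subst si sl a)) /\
  (forall si sl t b, subst si sl (lb t b) =
     lb (subst si sl t) (subst (upI 1 0 si) (upL 1 0 sl) b)).

Definition pair_formers (pr lp : exp -> exp -> exp) : Prop :=
  (forall si sl a b, subst si sl (pr a b) =
     pr (subst si sl a) (subst si sl b)) /\
  (forall si sl t c, subst si sl (lp t c) =
     lp (subst si sl t) (subst (upI 1 1 si) (upL 1 1 sl) c)).

End Syntax.

(* Main.v *)
Require Import Defs.
From mathcomp Require Import all_boot.

Set Implicit Arguments.
Unset Strict Implicit.
Unset Printing Implicit Defensive.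

(* [!A] is recovered from [Sigma_{!x:!A} I] by [!a := !a (x) *] and
   [let t be !x in b := let t be !x (x) y in let y be * in b]; conversely,
   [!a (x) b := let b be * in !a] and
   [let t be !x (x) y in c := let t be !x in c[*/y]].  The computation rules
   then follow from those of the given types because, by eta and the commuting
   conversions for [I], [c[t/y]] equals [let t be * in c[*/y]] for every
   [t : I].  Every rule is derived directly, without induction on derivations,
   so arbitrary additional rules are harmless. *)

#[local] Arguments ish {O} e.

(** * Fusion laws for renamings and substitutions in two index spaces *)

Section SubstitutionLemmas.
Context {O : Type}.
Implicit Types (e a b c d : exp O) (s si sl ti tl : nat -> exp O).
Implicit Types (r ri rl qi ql : nat -> nat).

(** The generated induction principle says nothing about the expressions nested in the list of [Op].
    The hypothesis on the arguments is a [foldr] so that it unfolds along an induction on that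
    list. *)
Lemma exp_nested_ind (P : exp O -> Prop) :
  (forall n, P (IVar n)) -> (forall n, P (LVar n)) ->
  (forall o args, foldr (fun x Q => P x.2 /\ Q) True args -> P (Op o args)) ->
  P Unit -> P Star ->
  (forall t a, P t -> P a -> P (LetStar t a)) ->
  (forall A, P A -> P (Bang A)) ->
  (forall a, P a -> P (BangI a)) ->
  (forall t b, P t -> P b -> P (LetBang t b)) ->
  (forall A B, P A -> P B -> P (Sigma A B)) ->
  (forall a b, P a -> P b -> P (Pair a b)) ->
  (forall t c, P t -> P c -> P (LetPair t c)) ->
  forall e, P e.
Proof.
move=> Pi Pl Pop Pu Ps Pls Pb Pbi Plb Psg Pp Plp; fix IH 1 => e.
case: e => [n|n|o args|||t a|A|a|t b|A B|a b|t c].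
- exact: Pi.
- exact: Pl.
- by apply: Pop; elim: args.
- exact: Pu.
- exact: Ps.
- exact: Pls.
- exact: Pb.
- exact: Pbi.
- exact: Plb.
- exact: Psg.
- exact: Pp.
- exact: Plp.
Qed.

Lemma upren_addn k r n : upren k r (k + n) = k + r n.
Proof. by rewrite /upren ltnNge leq_addr addKn. Qed.

Lemma upren1S r n : upren 1 r n.+1 = (r n).+1.
Proof. exact: (upren_addn 1). Qed.

Lemma eq_upI i l s s' : s =1 s' -> upI i l s =1 upI i l s'.
Proof. by move=> ss' n; rewrite /upI ss'. Qed.

Lemma eq_upL i l s s' : s =1 s' -> upL i l s =1 upL i l s'.
Proof. by move=> ss' n; rewrite /upL ss'. Qed.

Lemma upI_addn i l s n : upI i l s (i + n) = ren (addn i) (addn l) (s n).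
Proof. by rewrite /upI ltnNge leq_addr addKn. Qed.

Lemma upL_addn i l s n : upL i l s (l + n) = ren (addn i) (addn l) (s n).
Proof. by rewrite /upL ltnNge leq_addr addKn. Qed.

Lemma upI_upren i l s r : upI i l s \o upren i r =1 upI i l (s \o r).
Proof.
move=> n /=; rewrite {1}/upren; case: ltnP => [ltni|leni].
  by rewrite /upI ltni.
by rewrite upI_addn /upI ltnNge leni.
Qed.

Lemma upL_upren i l s r : upL i l s \o upren l r =1 upL i l (s \o r).
Proof.
move=> n /=; rewrite {1}/upren; case: ltnP => [ltnl|lenl].
  by rewrite /upL ltnl.
by rewrite upL_addn /upL ltnNge lenl.
Qed.

Lemma upI_IVar i l : upI i l (@IVar O) =1 IVar.
Proof. by move=> n; rewrite /upI; case: ltnP => //= lein; rewrite subnKC. Qed.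

Lemma upL_LVar i l : upL i l (@LVar O) =1 LVar.
Proof. by move=> n; rewrite /upL; case: ltnP => //= leln; rewrite subnKC. Qed.

Lemma eq_subst si si' sl sl' e :
  si =1 si' -> sl =1 sl' -> subst si sl e = subst si' sl' e.
Proof.
elim/exp_nested_ind: e si si' sl sl' => //=;
  do ?[by move=> *; f_equal; auto using eq_upI, eq_upL].
move=> o args IH si si' sl sl' eqi eql; congr (Op o _).
elim: args IH => //= x args IHargs [IHx /IHargs ->].
by rewrite (IHx _ (upI x.1.1 x.1.2 si') _ (upL x.1.1 x.1.2 sl'));
  auto using eq_upI, eq_upL.
Qed.

(** First of the fusion laws: a lifted renaming composes index by index with a lifted substitution,
    by [upI_upren] and [upL_upren]. *)
Lemma subst_ren si sl ri rl e :
  subst si sl (ren ri rl e) = subst (si \o ri) (sl \o rl) e.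
Proof.
elim/exp_nested_ind: e si sl ri rl => //=.
- move=> o args IH si sl ri rl; congr (Op o _).
  by elim: args IH => //= x args IHargs [IHx /IHargs ->];
    rewrite IHx (eq_subst _ (upI_upren _ _ _ _) (upL_upren _ _ _ _)).
- by move=> t a IHt IHa *; rewrite IHt IHa.
- by move=> A IHA *; rewrite IHA.
- by move=> a IHa *; rewrite IHa.
- move=> t b IHt IHb si sl ri rl; rewrite IHt IHb; congr LetBang.
  apply: eq_subst; first exact: upI_upren.
  by move=> n; rewrite /= /upL !subn0.
- move=> A B IHA IHB si sl ri rl; rewrite IHA IHB; congr Sigma.
  apply: eq_subst; first exact: upI_upren.
  by move=> n; rewrite /= /upL !subn0.
- by move=> a b IHa IHb *; rewrite IHa IHb.
- move=> t c IHt IHc *.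
  by rewrite IHt IHc (eq_subst _ (upI_upren _ _ _ _) (upL_upren _ _ _ _)).
Qed.

(** Renamings become substitutions, which makes [ren_ren] an instance of [subst_ren]. *)
Lemma renE ri rl e : ren ri rl e = subst (IVar \o ri) (LVar \o rl) e.
Proof.
have upIr i l r : upI i l (@IVar O \o r) =1 IVar \o upren i r.
  by move=> n; rewrite /upI /upren /=; case: ifP.
have upLr i l r : upL i l (@LVar O \o r) =1 LVar \o upren l r.
  by move=> n; rewrite /upL /upren /=; case: ifP.
elim/exp_nested_ind: e ri rl => //=.
- move=> o args IH ri rl; congr (Op o _).
  elim: args IH => //= x args IHargs [IHx /IHargs ->].
  by rewrite IHx (eq_subst _ (upIr _ _ _) (upLr _ _ _)).
- by move=> t a IHt IHa *; rewrite IHt IHa.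
- by move=> A IHA *; rewrite IHA.
- by move=> a IHa *; rewrite IHa.
- move=> t b IHt IHb ri rl; rewrite IHt IHb; congr LetBang.
  apply: eq_subst => n; first by rewrite upIr.
  by rewrite upLr /= /upren subn0.
- move=> A B IHA IHB ri rl; rewrite IHA IHB; congr Sigma.
  apply: eq_subst => n; first by rewrite upIr.
  by rewrite upLr /= /upren subn0.
- by move=> a b IHa IHb *; rewrite IHa IHb.
- move=> t c IHt IHc ri rl.
  by rewrite IHt IHc (eq_subst c (upIr 1 1 ri) (upLr 1 1 rl)).
Qed.

Lemma eq_ren ri ri' rl rl' e : ri =1 ri' -> rl =1 rl' ->
  ren ri rl e = ren ri' rl' e.
Proof.
by move=> eqi eql; rewrite !renE; apply: eq_subst => n /=; rewrite ?eqi ?eql.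
Qed.

Lemma ren_ren ri rl qi ql e :
  ren ri rl (ren qi ql e) = ren (ri \o qi) (rl \o ql) e.
Proof. by rewrite [LHS]renE subst_ren [RHS]renE. Qed.

(** Under binders, a lifted renaming commutes with the weakening built into a lifted substitution
    ([ren_up]). *)
Lemma ren_subst ri rl si sl e :
  ren ri rl (subst si sl e) = subst (ren ri rl \o si) (ren ri rl \o sl) e.
Proof.
have ren_up i l ri' rl' a :
    ren (upren i ri') (upren l rl') (ren (addn i) (addn l) a) =
    ren (addn i) (addn l) (ren ri' rl' a).
  by rewrite !ren_ren; apply: eq_ren => n /=; rewrite upren_addn.
have upIE i l ri' rl' s :
    ren (upren i ri') (upren l rl') \o upI i l s =1 upI i l (ren ri' rl' \o s).
  move=> n; rewrite /= /upI; case: ifP => [ltni|_]; last exact: ren_up.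
  by rewrite /= /upren ltni.
have upLE i l ri' rl' s :
    ren (upren i ri') (upren l rl') \o upL i l s =1 upL i l (ren ri' rl' \o s).
  move=> n; rewrite /= /upL; case: ifP => [ltnl|_]; last exact: ren_up.
  by rewrite /= /upren ltnl.
(* Under a purely intuitionistic binder [ren] leaves the linear renaming as it is, whereas [upLE]
   expects it lifted by zero. *)
have upren0 r : r =1 upren 0 r by move=> n; rewrite /upren subn0.
elim/exp_nested_ind: e ri rl si sl => //=.
- move=> o args IH ri rl si sl; congr (Op o _).
  elim: args IH => //= x args IHargs [IHx /IHargs ->].
  by rewrite IHx (eq_subst _ (upIE _ _ _ _ _) (upLE _ _ _ _ _)).
- by move=> t a IHt IHa *; rewrite IHt IHa.
- by move=> A IHA *; rewrite IHA.
- by move=> a IHa *; rewrite IHa.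
- move=> t b IHt IHb ri rl si sl; rewrite IHt; congr LetBang.
  rewrite (@eq_ren _ (upren 1 ri) _ (upren 0 rl)) // IHb.
  by rewrite (eq_subst _ (upIE _ _ _ _ _) (upLE _ _ _ _ _)).
- move=> A B IHA IHB ri rl si sl; rewrite IHA; congr Sigma.
  rewrite (@eq_ren _ (upren 1 ri) _ (upren 0 rl)) // IHB.
  by rewrite (eq_subst _ (upIE _ _ _ _ _) (upLE _ _ _ _ _)).
- by move=> a b IHa IHb *; rewrite IHa IHb.
- move=> t c IHt IHc ri rl si sl.
  by rewrite IHt IHc (eq_subst _ (upIE _ _ _ _ _) (upLE _ _ _ _ _)).
Qed.

(** The scheme of [ren_subst] again; the two mixed laws together show that lifted substitutions
    commute with weakening ([subst_up]). *)
Lemma subst_subst si sl ti tl e :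
  subst si sl (subst ti tl e) = subst (subst si sl \o ti) (subst si sl \o tl) e.
Proof.
have subst_up i l si' sl' a :
    subst (upI i l si') (upL i l sl') (ren (addn i) (addn l) a) =
    ren (addn i) (addn l) (subst si' sl' a).
  rewrite subst_ren ren_subst.
  by apply: eq_subst => n /=; rewrite ?upI_addn ?upL_addn.
have upIE i l si' sl' s :
    subst (upI i l si') (upL i l sl') \o upI i l s =1
    upI i l (subst si' sl' \o s).
  move=> n; rewrite /= /(upI i l s) /(upI i l (_ \o _)).
  case: ifP => [ltni|_]; last exact: subst_up.
  by rewrite /= /upI ltni.
have upLE i l si' sl' s :
    subst (upI i l si') (upL i l sl') \o upL i l s =1
    upL i l (subst si' sl' \o s).
  move=> n; rewrite /= /(upL i l s) /(upL i l (_ \o _)).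
  case: ifP => [ltnl|_]; last exact: subst_up.
  by rewrite /= /upL ltnl.
elim/exp_nested_ind: e si sl ti tl => //=.
- move=> o args IH si sl ti tl; congr (Op o _).
  elim: args IH => //= x args IHargs [IHx /IHargs ->].
  by rewrite IHx (eq_subst _ (upIE _ _ _ _ _) (upLE _ _ _ _ _)).
- by move=> t a IHt IHa *; rewrite IHt IHa.
- by move=> A IHA *; rewrite IHA.
- by move=> a IHa *; rewrite IHa.
- move=> t b IHt IHb si sl ti tl.
  by rewrite IHt IHb (eq_subst _ (upIE _ _ _ _ _) (upLE _ _ _ _ _)).
- move=> A B IHA IHB si sl ti tl.
  by rewrite IHA IHB (eq_subst _ (upIE _ _ _ _ _) (upLE _ _ _ _ _)).
- by move=> a b IHa IHb *; rewrite IHa IHb.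
- move=> t c IHt IHc si sl ti tl.
  by rewrite IHt IHc (eq_subst _ (upIE _ _ _ _ _) (upLE _ _ _ _ _)).
Qed.

Lemma subst_id si sl e : si =1 IVar -> sl =1 LVar -> subst si sl e = e.
Proof.
move=> eqi eql; rewrite {si sl eqi eql}(eq_subst e eqi eql).
have upE i l b :
    subst IVar LVar b = b -> subst (upI i l IVar) (upL i l LVar) b = b.
  move=> eqb; rewrite -[RHS]eqb.
  by apply: eq_subst; [exact: upI_IVar | exact: upL_LVar].
elim/exp_nested_ind: e => //=.
- move=> o args IH; congr (Op o _).
  by elim: args IH => //= -[p b] args IHargs [/= /upE -> /IHargs ->].
- by move=> t a -> ->.
- by move=> A ->.
- by move=> a ->.
- by move=> t b -> /upE ->.
- by move=> A B -> /upE ->.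
- by move=> a b -> ->.
- by move=> t c -> /upE ->.
Qed.

Lemma ren_id ri rl e : ri =1 id -> rl =1 id -> ren ri rl e = e.
Proof.
by move=> eqi eql; rewrite renE subst_id // => n /=; rewrite ?eqi ?eql.
Qed.

Lemma upI0 s : upI 0 0 s =1 s.
Proof. by move=> n; rewrite /upI subn0 ren_id. Qed.

Lemma iweak_at0 e : iweak_at 0 e = ish e.
Proof. by apply: eq_ren => // n; rewrite /upren subn0. Qed.

Lemma isub_at0 a e : isub_at 0 a e = isub a e.
Proof. by apply: eq_subst => // n; rewrite upI0. Qed.

Lemma isub_ish a e : isub a (ish e) = e.
Proof. by rewrite /isub /ish subst_ren subst_id. Qed.

Lemma lsub_lweak a e : lsub a (ren id S e) = e.
Proof. by rewrite /lsub subst_ren subst_id. Qed.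

Lemma ilsub_lweak a b c : ilsub a b (ren id S c) = isub a c.
Proof. by rewrite /ilsub subst_ren; apply: eq_subst. Qed.

(** [Star] is closed, so the second substitution leaves it alone; [a] enters after the linear one
    and is not touched by it. *)
Lemma isub_lsub_Star a c : isub a (lsub Star c) = ilsub a Star c.
Proof. by rewrite /isub /lsub subst_subst; apply: eq_subst => [n|[|n]]. Qed.

(* The renaming protects [b] from capturing linear variables of [a], which is
   a raw expression. *)
Lemma lsub_isub_lweak a b c : lsub b (isub (ren id S a) c) = ilsub a b c.
Proof.
rewrite /lsub /isub subst_subst; apply: eq_subst => [[|n]|n] //=.
exact: lsub_lweak.
Qed.

End SubstitutionLemmas.

(** * Names and types in linear regions *)

Section Regions.
Context {O : Type}.
Implicit Types (f : exp O -> exp O) (X : lctx O) (a B : exp O).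

Lemma unzip1_lnames r X : unzip1 (lnames r X) = map r (unzip1 X).
Proof. by rewrite /unzip1 /lnames -!map_comp. Qed.

Lemma distinct_ltypes f X : distinct (ltypes f X) = distinct X.
Proof. by rewrite /distinct /unzip1 /ltypes -map_comp. Qed.

Lemma ltypes_cat f X X' : ltypes f (X ++ X') = ltypes f X ++ ltypes f X'.
Proof. exact: map_cat. Qed.

Lemma ltypes_lnames f r X : ltypes f (lnames r X) = lnames r (ltypes f X).
Proof. by rewrite /ltypes /lnames -!map_comp. Qed.

Lemma ltypes_lext f X B : ltypes f (lext X B) = lext (ltypes f X) (f B).
Proof. by rewrite /lext ltypes_cat ltypes_lnames. Qed.

Lemma lext_cat X X' B : lext (X ++ X') B = lnames S X ++ lext X' B.
Proof. by rewrite /lext /lnames map_cat catA. Qed.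

(** The shifted names are successors, so they avoid the fresh name 0, and [S] is injective. *)
Lemma distinct_lext X B : distinct (lext X B) = distinct X.
Proof.
rewrite /distinct /unzip1 map_cat -/(unzip1 _) unzip1_lnames cat_uniq /= orbF.
rewrite (map_inj_uniq succn_inj) andbT; case: (0 \in _) / mapP => [[]|] //.
by rewrite andbT.
Qed.

(** Serves to move a program context under one more linear binder: [upren 1 S] keeps its hole at
    index 0 and shifts all other names. *)
Lemma lnames_lext X B : lnames (upren 1 S) (lext X B) = lext (lnames S X) B.
Proof.
rewrite /lext /lnames map_cat -!map_comp; congr (_ ++ _).
by apply: eq_map => p /=; rewrite upren1S.
Qed.

Lemma ltypes_isub_ish a X : ltypes (isub a) (ltypes ish X) = X.
Proof.
rewrite /ltypes -map_comp -[RHS]map_id.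
by apply: eq_map => -[x A] /=; rewrite isub_ish.
Qed.

Lemma distinct_catCA X X' X'' :
  distinct (X ++ X' ++ X'') = distinct (X' ++ X ++ X'').
Proof. by rewrite /distinct /unzip1 !map_cat uniq_catCA. Qed.

Lemma distinct_catr X X' : distinct (X ++ X') -> distinct X'.
Proof. by rewrite /distinct /unzip1 map_cat cat_uniq => /and3P[]. Qed.

Lemma distinct_catC X X' : distinct (X ++ X') = distinct (X' ++ X).
Proof. by rewrite /distinct /unzip1 !map_cat uniq_catC. Qed.

End Regions.

(** The premises become an iterated conjunction, which computes on a concrete list and can be split;
    [closed_under_intro] is the converse passage. *)
Lemma closed_by (O : Type) (R : rules O) (T : judgement O -> Prop) ps c :
  closed_under R T -> R ps c -> foldr (fun p => and (T p)) True ps -> T c.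
Proof.
move=> RT Rc Tps; apply: RT Rc _.
elim: ps Tps => //= q ps IH [Tq /IH{}IH] p [<-|/IH] //.
Qed.

Lemma closed_under_intro (O : Type) (R : rules O) (T : judgement O -> Prop) :
  (forall ps c, R ps c -> foldr (fun p => and (T p)) True ps -> T c) ->
  closed_under R T.
Proof.
move=> RT ps c /RT{RT} Tc Tps; apply: Tc.
elim: ps Tps => //= p ps IH Tps; split; first by apply: Tps; left.
by apply: IH => q ps_q; apply: Tps; right.
Qed.

(** * Consequences of the structural rules *)

Section DerivedRules.
Context {O : Type} (T : judgement O -> Prop).
Hypothesis strT : closed_under (@structural_rules O) T.
Implicit Types (a b c t A B C : exp O) (D : ictx O) (X Y : lctx O).
Implicit Type s : statement O.

Lemma eq_smap f f' g g' s : f =1 f' -> g =1 g' -> smap f g s = smap f' g' s.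
Proof. by move=> ff' gg'; case: s => *; rewrite /= ?ff' ?gg'. Qed.

(** Weakening with an empty telescope; [iweak_at 0] agrees with [ish] only up to a lemma, hence the
    rewriting in region and statement. *)
Lemma ishift_rule D A X s : T (Ty D A) -> T (Jdg D X s) ->
  T (Jdg (A :: D) (ltypes ish X) (smap ish ish s)).
Proof.
move=> TA Ts; have := closed_by strT (@s_weak O D A [::] X s).
rewrite /= (eq_smap s iweak_at0 iweak_at0).
by rewrite [ltypes _ X](eq_map (g := fun p => (p.1, ish p.2)))=> [|p];
   [apply | rewrite iweak_at0].
Qed.

Lemma isub_rule D A X a s : T (Tm D [::] a A) -> T (Jdg (A :: D) X s) ->
  T (Jdg D (ltypes (isub a) X) (smap (isub a) (isub a) s)).
Proof.
move=> Ta Ts; have := closed_by strT (@s_subst O D A [::] X a s).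
rewrite /= (eq_smap s (isub_at0 a) (isub_at0 a)).
by rewrite [ltypes _ X](eq_map (g := fun p => (p.1, isub a p.2)))=> [|p];
   [apply | rewrite isub_at0].
Qed.

Lemma isub_tm_rule D A B X a b :
  T (Tm D [::] a A) -> T (Tm (A :: D) (ltypes ish X) b (ish B)) ->
  T (Tm D X (isub a b) B).
Proof.
by move=> Ta /(isub_rule Ta); rewrite /= ltypes_isub_ish isub_ish.
Qed.

Lemma ctx_int_rule D A : T (Ctx D [::]) -> T (Ty D A) -> T (Ctx (A :: D) [::]).
Proof. by move=> TD TA; apply: (closed_by strT (s_ctx_int D [::] A)). Qed.

Lemma ivar0_rule D A :
  T (Ctx D [::]) -> T (Ty D A) -> T (Tm (A :: D) [::] (IVar 0) (ish A)).
Proof.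
move=> TD TA; apply: (closed_by strT (s_ivar D A [::])).
by split=> //; apply: ctx_int_rule.
Qed.

Lemma lvar_rule D A x :
  T (Ctx D [::]) -> T (Ty D A) -> T (Tm D [:: (x, A)] (LVar x) A).
Proof.
move=> TD TA; apply: (closed_by strT (s_lvar D x A)); split=> //.
exact: (closed_by strT (@s_ctx_lin O D [::] x A isT)).
Qed.

Lemma ty_refl_rule D A : T (Ty D A) -> T (TyEq D A A).
Proof. by move=> TA; apply: (closed_by strT (s_ty_refl D A)). Qed.

Lemma tm_refl_rule D X a A : T (Tm D X a A) -> T (TmEq D X a a A).
Proof. by move=> Ta; apply: (closed_by strT (s_tm_refl D X a A)). Qed.

Lemma tm_sym_rule D X a b A : T (TmEq D X a b A) -> T (TmEq D X b a A).
Proof. by move=> Tab; apply: (closed_by strT (s_tm_sym D X a b A)). Qed.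

Lemma tm_trans_rule D X a b c A :
  T (TmEq D X a b A) -> T (TmEq D X b c A) -> T (TmEq D X a c A).
Proof. by move=> Tab Tbc; apply: (closed_by strT (s_tm_trans D X a b c A)). Qed.

Lemma lname_rule D X r s : injective r -> T (Jdg D X s) ->
  T (Jdg D (lnames r X) (smap id (ren id r) s)).
Proof. by move=> injr Ts; apply: (closed_by strT (s_lname D X s injr)). Qed.

Lemma lshift_rule D X s :
  T (Jdg D X s) -> T (Jdg D (lnames S X) (smap id (ren id S) s)).
Proof. exact/lname_rule/succn_inj. Qed.

Lemma lsub_rule D X X' A a s : distinct (X ++ X') ->
  T (Jdg D (lext X A) s) -> T (Tm D X' a A) ->
  T (Jdg D (X ++ X') (smap id (lsub a) s)).
Proof. by move=> uX Ts Ta; apply: (closed_by strT (s_lsubst D A a s uX)). Qed.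

(** The entry [q] travels left across [Y] by adjacent transpositions. *)
Lemma lexch_move D X Y q Z s :
  T (Jdg D (X ++ Y ++ q :: Z) s) -> T (Jdg D (X ++ q :: Y ++ Z) s).
Proof.
elim: Y X => //= p Y IH X Ts.
apply: (closed_by strT (s_lexch D X (Y ++ Z) p q s)); split=> //.
by rewrite -cat_rcons; apply: IH; rewrite cat_rcons.
Qed.

Lemma lexch_cat D X Y Z W s :
  T (Jdg D (X ++ Y ++ Z ++ W) s) -> T (Jdg D (X ++ Z ++ Y ++ W) s).
Proof.
elim: Z X => //= q Z IH X Ts.
(* Once [q] has crossed [Y], it is absorbed into the prefix [X] and the rest of [Z] follows. *)
by rewrite -cat_rcons; apply: IH; rewrite cat_rcons; apply: lexch_move.
Qed.

Lemma lexch_catC D X Y s : T (Jdg D (X ++ Y) s) -> T (Jdg D (Y ++ X) s).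
Proof. by have := @lexch_cat D [::] X Y [::] s; rewrite !cats0. Qed.

End DerivedRules.

(** * Elimination of variables and terms of type [Unit] *)

Section UnitElimination.
Context {O : Type} (T : judgement O -> Prop).
Hypothesis strT : closed_under (@structural_rules O) T.
Hypothesis unitT : closed_under (@unit_rules O) T.
Implicit Types (a b c t A B C : exp O) (D : ictx O) (X Y : lctx O).

Lemma unit_ty_rule D : T (Ctx D [::]) -> T (Ty D Unit).
Proof. by move=> TD; apply: (closed_by unitT (unit_F D)). Qed.

Lemma star_rule D : T (Ctx D [::]) -> T (Tm D [::] Star Unit).
Proof. by move=> TD; apply: (closed_by unitT (unit_I D)). Qed.

Lemma unit_lvar_rule D x :
  T (Ctx D [::]) -> T (Tm D [:: (x, Unit)] (LVar x) Unit).
Proof. by move=> TD; apply: lvar_rule => //; apply: unit_ty_rule. Qed.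

(** Types the body of [sigma_let_bang]: the second component [y], of index 0, is consumed by
    [LetStar]. *)
Lemma let_lvar0_rule D X b B : distinct X -> T (Ctx D [::]) ->
  T (Tm D X b B) -> T (Tm D (lext X Unit) (LetStar (LVar 0) (ren id S b)) B).
Proof.
move=> uX TD Tb; move: uX; rewrite -(distinct_lext X Unit) => uX.
apply: (closed_by unitT (unit_E D (LVar 0) (ren id S b) B uX)).
by split; [exact: unit_lvar_rule | split; [exact: lshift_rule Tb |]].
Qed.

Lemma let_lvar0_eq_rule D X b b' B : distinct X -> T (Ctx D [::]) ->
  T (TmEq D X b b' B) ->
  T (TmEq D (lext X Unit) (LetStar (LVar 0) (ren id S b))
       (LetStar (LVar 0) (ren id S b')) B).
Proof.
move=> uX TD Tb; move: uX; rewrite -(distinct_lext X Unit) => uX.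
apply: (closed_by unitT
  (unit_E_eq D (LVar 0) (LVar 0) (ren id S b) (ren id S b') B uX)).
split; last by split; [exact: lshift_rule Tb |].
by apply: tm_refl_rule => //; apply: unit_lvar_rule.
Qed.

(* [t] is [let t be * in *] by eta, and this [let] commutes with the hole of
   [c]. *)
Lemma let_star_hole_rule D X Y t c C :
  distinct (X ++ Y) -> T (Ctx D [::]) ->
  T (Tm D Y t Unit) -> T (Tm D (lext X Unit) c C) ->
  T (TmEq D (X ++ Y) (lsub t c) (LetStar t (lsub Star c)) C).
Proof.
move=> uXY TD Tt Tc; apply: (tm_trans_rule strT (b := lsub (LetStar t Star) c)).
  apply: (tm_sym_rule strT).
  apply: (closed_by strT (s_lsubst_eq D Unit (LetStar t Star) t c C uXY)).
  split=> //; split=> //.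
  have uY := distinct_catr uXY.
  exact: (closed_by unitT (unit_eta D t uY)).
(* The [let] sitting in the hole has body [Star], whose region is empty. *)
apply: (closed_by unitT (@unit_comm O D [::] Y X t Star Unit c C uXY)).
by split=> //; split=> //; exact: star_rule.
Qed.

End UnitElimination.

(** * The rules of [!A] for the type [Sigma A Unit] *)

Section BangFromSigma.
Context {O : Type} (T : judgement O -> Prop).
Implicit Types (a b t : exp O).

Definition sigma_bangI a : exp O := Pair a Star.
Definition sigma_let_bang t b : exp O :=
  LetPair t (LetStar (LVar 0) (ren id S b)).

(** Weakening the body by [y] commutes with a substitution lifted past [y]. *)
Lemma sigma_bang_formers : bang_formers sigma_bangI sigma_let_bang.
Proof.
split=> // si sl t b; rewrite /sigma_let_bang /=.
congr (LetPair _ (LetStar _ _)); rewrite subst_ren ren_subst.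
apply: eq_subst => n /=.
  by rewrite /upI; case: ifP => //= _; rewrite ren_ren.
by rewrite /upL /= subSS !subn0 ren_ren.
Qed.

Hypothesis strT : closed_under (@structural_rules O) T.
Hypothesis unitT : closed_under (@unit_rules O) T.
Hypothesis sigT :
  closed_under (sigma_rules (fun=> True) (@Sigma O) (@Pair O) (@LetPair O)) T.

Lemma sigma_is_bang :
  closed_under
    (bang_rules (fun A => Sigma A Unit) sigma_bangI sigma_let_bang) T.
Proof.
have Tunit D A : T (Ctx D [::]) -> T (Ty D A) -> T (Ty (A :: D) Unit).
  by move=> TD TA; apply: unit_ty_rule => //; apply: ctx_int_rule.
have Tsigma D A : T (Ctx D [::]) -> T (Ty D A) -> T (Ty D (Sigma A Unit)).
  move=> TD TA; apply: (closed_by sigT (sigma_F _ _ _ D A I)).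
  by do !split=> //; apply: Tunit.
have Tpair D A a X b : distinct X -> T (Ctx D [::]) -> T (Ty D A) ->
    T (Tm D [::] a A) -> T (Tm D X b Unit) ->
    T (Tm D X (Pair a b) (Sigma A Unit)).
  move=> uX TD TA Ta Tb.
  apply: (closed_by sigT (@sigma_I O _ _ _ _ D A Unit X a b I uX)).
  by do !split=> //; apply: Tunit.
have Tpair_eq D A a a' X b b' : distinct X -> T (Ctx D [::]) -> T (Ty D A) ->
    T (TmEq D [::] a a' A) -> T (TmEq D X b b' Unit) ->
    T (TmEq D X (Pair a b) (Pair a' b') (Sigma A Unit)).
  move=> uX TD TA Ta Tb.
  apply: (closed_by sigT (@sigma_I_eq O _ _ _ _ D A Unit X a a' b b' I uX)).
  by do !split=> //; apply: Tunit.
apply: closed_under_intro => ps j [] {ps j}.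
- by move=> D A /= [TD [TA _]]; apply: Tsigma.
- move=> D A A' /= [TD [TA [TA' [TAA' _]]]].
  apply: (closed_by sigT (@sigma_F_eq O _ _ _ _ D A A' Unit Unit I I)).
  by do !split=> //; [exact: Tunit | exact: Tunit | apply: ty_refl_rule => //;
    exact: Tunit].
- by move=> D A a /= [TD [TA [Ta _]]]; apply: Tpair => //; apply: star_rule.
- move=> D A a a' /= [TD [TA [Ta _]]]; apply: Tpair_eq => //.
  by apply: tm_refl_rule => //; apply: star_rule.
- move=> D A B X X' t b uX /= [TD [TA [TB [Tt [Tb _]]]]].
  pose c := LetStar (LVar 0) (ren id S b).
  apply: (closed_by sigT (@sigma_E O _ _ _ _ D A Unit B X X' t c I uX)).
  do !split=> //; first exact: Tunit.
  apply: let_lvar0_rule => //; last exact: ctx_int_rule.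
  by rewrite distinct_ltypes (distinct_catr uX).
- move=> D A B X X' t t' b b' uX /= [TD [TA [TB [Tt [Tb _]]]]].
  pose c u : exp O := LetStar (LVar 0) (ren id S u).
  apply: (closed_by sigT
    (@sigma_E_eq O _ _ _ _ D A Unit B X X' t t' (c b) (c b') I uX)).
  do !split=> //; first exact: Tunit.
  apply: let_lvar0_eq_rule => //; last exact: ctx_int_rule.
  by rewrite distinct_ltypes (distinct_catr uX).
- move=> D A B X a b uX /= [TD [TA [TB [Ta [Tb _]]]]].
  (* Sigma-beta substitutes [Star] for [y], which leaves a [let] on [Star]; the beta rule of [Unit]
     removes it. *)
  apply: (tm_trans_rule strT (b := LetStar Star (isub a b))); last first.
    have Tab := isub_tm_rule strT Ta Tb.
    by apply: (closed_by unitT (unit_beta D (isub a b) B uX)).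
  pose c := LetStar (LVar 0) (ren id S b).
  rewrite -(ilsub_lweak a Star b).
  apply: (closed_by sigT
    (@sigma_beta O _ _ _ _ D A Unit B [::] X a Star c I uX)).
  do !split=> //; [exact: Tunit | exact: star_rule |].
  apply: let_lvar0_rule => //; last exact: ctx_int_rule.
  by rewrite distinct_ltypes.
- move=> D A X t uX /= [TD [TA [Tt _]]].
  have TD' := ctx_int_rule strT TD TA.
  have TA' : T (Ty (A :: D) (ish A)) by apply: (ishift_rule strT TA TA).
  have Tx := ivar0_rule strT TD TA.
  (* Sigma-eta applies once the body is [Pair (IVar 0) (LVar 0)]. That pair, with its second
     component as hole, equals the actual body by [let_star_hole_rule] for the variable [y]. *)
  apply: (tm_trans_rule strT (b := LetPair t (Pair (IVar 0) (LVar 0))));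
    last first.
    apply: (closed_by sigT (@sigma_eta O _ _ _ _ D A Unit X t I uX)).
    by do !split=> //; apply: Tunit.
  have uX0 : distinct (X ++ [::]) by rewrite cats0.
  have := closed_by sigT (@sigma_E_eq O _ _ _ _ D A Unit (Sigma A Unit) X [::]
    t t (LetStar (LVar 0) (Pair (IVar 0) Star)) (Pair (IVar 0) (LVar 0)) I uX0).
  rewrite cats0; apply; do !split=> //; [exact: Tunit | exact: Tsigma | |].
    exact: tm_refl_rule.
  apply: (tm_sym_rule strT).
  apply: (let_star_hole_rule strT unitT (X := [::]) (t := LVar 0)
    (c := Pair (IVar 0) (LVar 0))) => //.
    exact: unit_lvar_rule.
  by apply: Tpair => //; exact: unit_lvar_rule.
- move=> D A B C X X' X'' t b c uX /= [TD [TA [TB [TC [Tt [Tb [Tc _]]]]]]].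
  have TD' := ctx_int_rule strT TD TA.
  pose b' := LetStar (LVar 0) (ren id S b).
  have uX2 : distinct (X ++ X'' ++ X') by rewrite distinct_catCA.
  have uX3 := distinct_catr uX2.
  have Tb' : T (Tm (A :: D) (lext (ltypes ish X') Unit) b' (ish B)).
    apply: let_lvar0_rule => //.
    by rewrite distinct_ltypes (distinct_catr uX3).
  (* Two conversions: the one for Sigma moves [c] inside [LetPair], then the one for [Unit] moves it
     inside [LetStar]. *)
  apply: (tm_trans_rule strT (b := LetPair t (lsub b' (ren S (upren 1 S) c)))).
    apply: (closed_by sigT
      (@sigma_comm O _ _ _ _ D A Unit B C X X' X'' t b' c I uX)).
    by do !split=> //; apply: Tunit.
  (* The elimination rule puts the region of [t] first, while the commuting conversion has it after
     [X'']. *)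
  apply: (lexch_cat strT (X := [::]) (Y := X) (Z := X'') (W := X')) => //=.
  apply: (closed_by sigT (@sigma_E_eq O _ _ _ _ D A Unit C X (X'' ++ X') t t
    _ (LetStar (LVar 0) (ren id S (lsub b (ish c)))) I uX2)).
  do !split=> //; [exact: Tunit | exact: tm_refl_rule |].
  have -> : ren id S (lsub b (ish c)) =
      lsub (ren id S b) (ren S (upren 1 S) c).
    rewrite /lsub /ish !subst_ren ren_subst.
    by apply: eq_subst => [n|[|n]] //; rewrite /comp upren1S.
  move: uX3; rewrite -(distinct_ltypes ish) -(distinct_lext _ Unit).
  rewrite ltypes_cat lext_cat => uX3.
  apply: (closed_by unitT (@unit_comm O (A :: D) (lnames S (ltypes ish X'))
    [:: (0, Unit)] (lnames S (ltypes ish X'')) (LVar 0) (ren id S b) (ish B)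
    (ren S (upren 1 S) c) (ish C) uX3)).
  do !split=> //; [exact: unit_lvar_rule | exact: lshift_rule Tb |].
  (* [c] is brought under [x] by weakening and under [y] by a renaming that fixes its hole. *)
  have injS : injective (upren 1 S).
    by move=> [|m] [|n] //; rewrite !upren1S => -[->].
  have := lname_rule strT injS (ishift_rule strT TA Tc).
  by rewrite ltypes_lext lnames_lext /= /ish ren_ren.
Qed.

End BangFromSigma.

(** * The rules of [Sigma A Unit] for the type [Bang A] *)

Section SigmaFromBang.
Context {O : Type} (T : judgement O -> Prop).
Implicit Types (a b c t : exp O).

Definition bang_pair a b : exp O := LetStar b (BangI a).
Definition bang_let_pair t c : exp O := LetBang t (lsub Star c).

(** The term put for [y] is the closed [Star], so replacing [y] commutes with lifted
    substitutions. *)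
Lemma bang_pair_formers : pair_formers bang_pair bang_let_pair.
Proof.
split=> // si sl t c; rewrite /bang_let_pair /=; congr (LetBang _ _).
rewrite /lsub !subst_subst; apply: eq_subst => [n|[|n]] //=.
  by rewrite /upI; case: ifP => //= _; rewrite subst_ren renE.
by rewrite /upL /= subSS !subn0 subst_ren renE.
Qed.

Hypothesis strT : closed_under (@structural_rules O) T.
Hypothesis unitT : closed_under (@unit_rules O) T.
Hypothesis bangT :
  closed_under (bang_rules (@Bang O) (@BangI O) (@LetBang O)) T.

Lemma bang_is_sigma :
  closed_under
    (sigma_rules (fun B => B = Unit) (fun A _ => Bang A)
       bang_pair bang_let_pair) T.
Proof.
have Tlsub D A X c C : distinct X -> T (Ctx D [::]) -> T (Ty D A) ->
    T (Tm (A :: D) (lext (ltypes ish X) Unit) c C) ->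
    T (Tm (A :: D) (ltypes ish X) (lsub Star c) C).
  move=> uX TD TA Tc; have TD' := ctx_int_rule strT TD TA.
  rewrite -[ltypes ish X]cats0.
  apply: (lsub_rule strT _ Tc (star_rule unitT TD')).
  by rewrite cats0 distinct_ltypes.
apply: closed_under_intro => ps j [] {ps j}.
- move=> D A B _ /= [TD [TA _]].
  by apply: (closed_by bangT (bang_F _ _ _ D A)).
- move=> D A A' B B' _ _ /= [TD [TA [_ [TA' [_ [TAA' _]]]]]].
  by apply: (closed_by bangT (bang_F_eq _ _ _ D A A')).
- move=> D A B X a b -> uX /= [TD [TA [_ [Ta [Tb _]]]]].
  apply: (closed_by unitT
    (@unit_E O D [::] X b (BangI a) (Bang A) uX)).
  do !split=> //.
  by apply: (closed_by bangT (bang_I _ _ _ D A a)).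
- move=> D A B X a a' b b' -> uX /= [TD [TA [_ [Ta [Tb _]]]]].
  apply: (closed_by unitT
    (@unit_E_eq O D [::] X b b' (BangI a) (BangI a') (Bang A) uX)).
  do !split=> //.
  by apply: (closed_by bangT (bang_I_eq _ _ _ D A a a')).
- move=> D A B C X X' t c -> uX /= [TD [TA [_ [TC [Tt [Tc _]]]]]].
  apply: (closed_by bangT
    (@bang_E O _ _ _ D A C X X' t (lsub Star c) uX)).
  by do !split=> //; apply: Tlsub => //; exact: distinct_catr uX.
- move=> D A B C X X' t t' c c' -> uX /= [TD [TA [_ [TC [Tt [Tc _]]]]]].
  have TD' := ctx_int_rule strT TD TA.
  apply: (closed_by bangT
    (@bang_E_eq O _ _ _ D A C X X' t t' (lsub Star c) (lsub Star c') uX)).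
  do !split=> //; rewrite -[ltypes ish X']cats0.
  apply: (lsub_rule strT _ Tc (star_rule unitT TD')).
  by rewrite cats0 distinct_ltypes (distinct_catr uX).
(* Beta is a chain of three equations, proved from the last to the first: the [let] on [b] moves out
   of the scrutinee of [LetBang], the beta rule of [Bang] fires under it, and [let_star_hole_rule]
   turns the result into c[a/x, b/y]. *)
- move=> D A B C X X' a b c -> uX /= [TD [TA [_ [TC [Ta [Tb [Tc _]]]]]]].
  have uX' := distinct_catr uX.
  have uXC : distinct (X' ++ X) by rewrite distinct_catC.
  have Tbang : T (Ty D (Bang A)) by apply: (closed_by bangT (bang_F _ _ _ D A)).
  (* Renaming leaves the empty region of [a] unchanged, so the shifted [a] keeps its typing. *)
  have Ta' : T (Tm D [::] (ren id S a) A) := lshift_rule strT Ta.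
  have Te : T (Tm D (lext X' Unit) (isub (ren id S a) c) C).
    have := isub_rule strT Ta' Tc.
    by rewrite /= isub_ish ltypes_lext ltypes_isub_ish.
  pose c' := lsub Star c.
  have Tc' := Tlsub _ _ _ _ _ uX' TD TA Tc.
  (* A [LetStar] on [b] lists the region [X] of [b] last. *)
  apply: (lexch_catC strT).
  pose e := isub (ren id S a) c.
  apply: (tm_trans_rule strT (b := LetStar b (lsub Star e))); last first.
    rewrite -lsub_isub_lweak; apply: (tm_sym_rule strT).
    exact: let_star_hole_rule.
  apply: (tm_trans_rule strT (b := LetStar b (LetBang (BangI a) c')));
    last first.
    have := closed_by unitT (@unit_E_eq O D X' X b b (LetBang (BangI a) c')
      (lsub Star (isub (ren id S a) c)) C uXC).
    apply; split; first exact: tm_refl_rule.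
    split=> //; rewrite lsub_isub_lweak -isub_lsub_Star.
    apply: (closed_by bangT (@bang_beta O _ _ _ D A C X' a c' uX')).
    by do !split.
  (* The program context whose hole is the scrutinee of [LetBang]. *)
  pose d : exp O := LetBang (LVar 0) (ren id S c').
  have lsub_d u : lsub u d = LetBang u c'.
    rewrite /lsub /= subst_ren; congr (LetBang _ _).
    apply: subst_id => n; first exact: upI_IVar.
    exact: (upL_addn 1 0 (scons u LVar) n.+1).
  rewrite /bang_let_pair -/c' -!lsub_d.
  apply: (closed_by unitT
    (@unit_comm O D [::] X X' b (BangI a) (Bang A) d C uXC)).
  do !split=> //; first by apply: (closed_by bangT (bang_I _ _ _ D A a)).
  (* [bang_E] lists the region of the scrutinee, here the hole, first, whereas [lext] puts it
     last. *)
  apply: (lexch_catC strT).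
  have uXd : distinct ([:: (0, Bang A)] ++ lnames S X').
    by rewrite distinct_catC (distinct_lext X' (Bang A)).
  apply: (closed_by bangT (@bang_E O _ _ _ D A C _ _ (LVar 0) _ uXd)).
  do !split=> //; first exact: lvar_rule.
  by rewrite ltypes_lnames; apply: lshift_rule Tc'.
- move=> D A B X t -> uX /= [TD [TA [_ [Tt _]]]].
  have TD' := ctx_int_rule strT TD TA.
  have Tbang : T (Ty D (Bang A)) by apply: (closed_by bangT (bang_F _ _ _ D A)).
  have TA' : T (Ty (A :: D) (ish A)) by apply: (ishift_rule strT TA TA).
  have TbI : T (Tm (A :: D) [::] (BangI (IVar 0)) (Bang (ish A))).
    apply: (closed_by bangT (bang_I _ _ _ (A :: D) (ish A) (IVar 0))).
    by do !split=> //; apply: ivar0_rule.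
  (* With [Star] for [y], the body is a [let] on [Star] around [BangI (IVar 0)]; the beta rule of
     [Unit] under the binder reduces it, and the eta rule of [Bang] finishes. *)
  apply: (tm_trans_rule strT (b := LetBang t (BangI (IVar 0)))); last first.
    by apply: (closed_by bangT (bang_eta _ _ _ D A t uX)).
  have uX0 : distinct (X ++ [::]) by rewrite cats0.
  have := closed_by bangT (@bang_E_eq O _ _ _ D A (Bang A) X [::]
    t t (LetStar Star (BangI (IVar 0))) (BangI (IVar 0)) uX0).
  rewrite cats0; apply; do !split=> //; first exact: tm_refl_rule.
  by apply: (closed_by unitT (@unit_beta O (A :: D) [::] _ (Bang (ish A)) isT)).
- move=> D A B C C' X X' X'' t c d -> uX.
  move=> /= [TD [TA [_ [TC [TC' [Tt [Tc [Td _]]]]]]]].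
  (* Putting [Star] for [y] undoes the linear weakening of [d], so only the filling [c] sees the
     substitution. *)
  have -> : bang_let_pair t (lsub c (ren S (upren 1 S) d)) =
      LetBang t (lsub (lsub Star c) (ish d)).
    congr (LetBang _ _); rewrite /lsub /ish !subst_ren subst_subst.
    by apply: eq_subst => [n|[|n]] //; rewrite /comp upren1S.
  apply: (closed_by bangT
    (@bang_comm O _ _ _ D A C C' X X' X'' t (lsub Star c) d uX)).
  do !split=> //; apply: Tlsub => //.
  exact: distinct_catr (distinct_catr uX).
Qed.

End SigmaFromBang.

(** Rules included in [R] are applied as such, whatever else [R] contains; this admits an arbitrary
    [extra]. *)
Lemma derivable_closed_under (O : Type) (R R' : rules O) :
  (forall ps c, R' ps c -> R ps c) -> closed_under R' (derivable R).
Proof. by move=> sub ps c /sub; apply: by_rule. Qed.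

Theorem theorem3 (O : Type) :
  (exists (bi : exp O -> exp O) (lb : exp O -> exp O -> exp O),
     bang_formers bi lb /\
     forall extra : rules O,
       closed_under (bang_rules (fun A => Sigma A Unit) bi lb)
         (ILDTT (rules_union (@unit_rules O)
           (rules_union
              (sigma_rules (fun=> True) (@Sigma O) (@Pair O) (@LetPair O))
              extra))))
  /\
  (exists pr lp : exp O -> exp O -> exp O,
     pair_formers pr lp /\
     forall extra : rules O,
       closed_under (sigma_rules (fun B => B = Unit) (fun A _ => Bang A) pr lp)
         (ILDTT (rules_union (@unit_rules O)
           (rules_union
              (bang_rules (@Bang O) (@BangI O) (@LetBang O))
              extra)))).
Proof.
split.
- exists (@sigma_bangI O), (@sigma_let_bang O); split=> [|extra].
    exact: sigma_bang_formers.
  by apply: sigma_is_bang; apply: derivable_closed_under => ps c Rc;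
     [left | right; left | right; right; left].
- exists (@bang_pair O), (@bang_let_pair O); split=> [|extra].
    exact: bang_pair_formers.
  by apply: bang_is_sigma; apply: derivable_closed_under => ps c Rc;
     [left | right; left | right; right; left].
Qed.
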